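(* (a) Let $X$ be a real Banach space and let $Z\subseteq Y\subseteq X$ be closed subspaces of $X$, where $Y$ has property-$SU$ in $X$. Then $Y/Z$ has property-$SU$ in $X/Z$. (b) Let $X$ be an $L_1$-predual. Let $Y$ be a closed subspace of $X$ which has property-$SU$ in $X$ and let $J$ be an $M$-ideal in $Y$. Then $Y/J$ is an $L_1$-predual.
   Context: All Banach spaces are real and subspaces are closed. For a closed subspace $Y$ of a Banach space $X$, $Y^\perp\subseteq X^*$ denotes the annihilator of $Y$. $Y$ has property-$SU$ in $X$ if $Y^\perp$ has a complementary subspace $G\subseteq X^*$ such that for every $f\in X^*$, writing $f=g+h$ with $g\in G$, $h\in Y^\perp$, one has $\|f\|>\|g\|$ whenever $h\neq 0$. A subspace $J$ of $Y$ is an $M$-ideal in $Y$ if its annihilator $J^\perp\subseteq Y^*$ is an $L$-summand in $Y^*$, i.e. it is the range of a linear projection $P:Y^*\to Y^*$ with $\|f\|=\|Pf\|+\|f-Pf\|$ for all $f\in Y^*$. An $L_1$-predual is a Banach space $X$ such that $X^*$ is isometrically isomorphic to $L_1(\mu)$ for some measure space $(\Omega,\Sigma,\mu)$. *)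

(* Defs.v *)
From HB Require Import structures.
From mathcomp Require Import all_boot all_order all_algebra.
From mathcomp Require Import generic_quotient.
From mathcomp Require Import all_classical all_reals all_analysis measurable_realfun.

Set Implicit Arguments.
Unset Strict Implicit.
Unset Printing Implicit Defensive.

Import Order.TTheory GRing.Theory Num.Theory.
Import numFieldNormedType.Exports.

Local Open Scope classical_set_scope.
Local Open Scope ring_scope.

(* The structure [submodClosed] does not provide closure under opposite, which
   quotients and submodule types need; the factory used below provides both. *)
Record submodule (K : pzRingType) (V : lmodType K) := Submodule {
  submod_pred :> {pred V};
  submod_predP : submod_closed submod_pred
}.

HB.instance Definition _ (K : pzRingType) (V : lmodType K) (S : submodule V) :=
  GRing.isSubmodClosed.Build K V (submod_pred S) (submod_predP S).

Record closed_subspace (R : realType) (X : normedModType R) := ClosedSubspace {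
  closed_submod :> submodule X;
  closed_submodP : closed [set x | x \in closed_submod]
}.

Section dual.
Context {R : realType} (X : normedModType R).

Definition dual_pred : {pred X -> R^o} :=
  mem [set f : X -> R^o | linear f /\ continuous f].

Record dual := Dual {dual_fun :> X -> R^o; dual_funP : dual_fun \in dual_pred}.

HB.instance Definition _ := [isSub for dual_fun].
HB.instance Definition _ := [Choice of dual by <:].

Fact dual_submod_closed : submod_closed dual_pred.
Proof.
split; first by rewrite inE; split=> [a x y|];
  [rewrite scaler0 addr0|exact: cst_continuous].
move=> a f g; rewrite !inE => -[lf cf] [lg cg]; split=> [b x y|x].
  have -> z : (a *: f + g) z = a *: f z + g z by [].
  by rewrite lf lg !scalerDr !scalerA addrACA (mulrC a).
by apply: continuousD; [apply: continuousZl_tmp; exact: cf|exact: cg].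
Qed.

HB.instance Definition _ :=
  GRing.isSubmodClosed.Build R (X -> R^o) dual_pred dual_submod_closed.
HB.instance Definition _ := [SubChoice_isSubLmodule of dual by <:].

Lemma dual_linear (f : dual) : linear f.
Proof. by have := dual_funP f; rewrite inE => -[]. Qed.

HB.instance Definition _ (f : dual) :=
  GRing.isLinear.Build R X R^o *:%R f (@dual_linear f).

Lemma dual_continuous (f : dual) : continuous f.
Proof. by have := dual_funP f; rewrite inE => -[]. Qed.

Definition dual_norm (f : dual) : R :=
  sup [set `|f x| | x in [set x : X | `|x| <= 1]].

Lemma dual_norm_has_sup (f : dual) :
  has_sup [set `|f x| | x in [set x : X | `|x| <= 1]].
Proof.
split; first by exists `|f 0|, 0 => //=; rewrite normr0.
have /linear_bounded_continuous/bounded_funP/(_ 1)[M fM] := @dual_continuous f.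
by exists M => _ [x /= x1 <-]; exact: fM.
Qed.

Lemma dual_norm_ub (f : dual) x : `|f x| <= dual_norm f * `|x|.
Proof.
have [->|x0] := eqVneq x 0; first by rewrite linear0 !normr0 mulr0.
rewrite -ler_pdivrMr ?normr_gt0//.
have -> : `|f x| / `|x| = `|f (`|x|^-1 *: x)|.
  by rewrite linearZ normrZ ger0_norm ?invr_ge0// mulrC.
apply: sup_upper_bound; first exact: dual_norm_has_sup.
exists (`|x|^-1 *: x) => //=.
by rewrite normrZ ger0_norm ?invr_ge0// mulVf ?normr_eq0.
Qed.

Lemma dual_norm_le (f : dual) c :
  (forall x, `|x| <= 1 -> `|f x| <= c) -> dual_norm f <= c.
Proof.
move=> fc; apply: ge_sup; first by case: (dual_norm_has_sup f).
by move=> _ [x /= x1 <-]; exact: fc.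
Qed.

Fact dual_normD (f g : dual) : dual_norm (f + g) <= dual_norm f + dual_norm g.
Proof.
apply: dual_norm_le => x x1; apply: (le_trans (ler_normD _ _)).
apply: lerD; apply: sup_upper_bound; try exact: dual_norm_has_sup; by exists x.
Qed.

Fact dual_normZ a (f : dual) : dual_norm (a *: f) = `|a| * dual_norm f.
Proof.
have le b (h : dual) : dual_norm (b *: h) <= `|b| * dual_norm h.
  apply: dual_norm_le => x x1; rewrite [X in `|X|](_ : _ = b * h x)// normrM.
  apply: ler_wpM2l => //; apply: sup_upper_bound; last by exists x.
  exact: dual_norm_has_sup.
apply/eqP; rewrite eq_le le/=.
have [->|a0] := eqVneq a 0.
  rewrite normr0 mul0r; apply: le_trans (normr_ge0 ((0 *: f : dual) 0)) _.
  by apply: sup_upper_bound; [exact: dual_norm_has_sup|exists 0; rewrite //= normr0].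
rewrite -ler_pdivlMl ?normr_gt0// -normfV.
by have := le a^-1 (a *: f); rewrite scalerA mulVf// scale1r.
Qed.

Fact dual_norm0_eq0 (f : dual) : dual_norm f = 0 -> f = 0.
Proof.
move=> f0; apply/val_inj/funext => x; apply/normr0_eq0/le_anti.
by rewrite normr_ge0 andbT (le_trans (dual_norm_ub f x))// f0 mul0r.
Qed.

HB.instance Definition _ :=
  Lmodule_isNormed.Build R dual dual_normD dual_normZ dual_norm0_eq0.

End dual.
Arguments dual_pred {R} X.
Arguments dual_fun {R X} _.
Arguments dual_linear {R X} _.
Arguments dual_continuous {R X} _.
Arguments dual_norm {R X} _.

Section sub_space.
Context {R : realType} (X : normedModType R) (Y : closed_subspace X).

Record sub_space := SubSpace {sub_val :> X; sub_valP : sub_val \in Y}.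

HB.instance Definition _ := [isSub for sub_val].
HB.instance Definition _ := [Choice of sub_space by <:].
HB.instance Definition _ := [SubChoice_isSubLmodule of sub_space by <:].

Definition sub_norm (y : sub_space) : R := `|sub_val y|.

Fact sub_normD x y : sub_norm (x + y) <= sub_norm x + sub_norm y.
Proof. exact: ler_normD. Qed.

Fact sub_normZ a y : sub_norm (a *: y) = `|a| * sub_norm y.
Proof. exact: normrZ. Qed.

Fact sub_norm0_eq0 y : sub_norm y = 0 -> y = 0.
Proof. by move=> /normr0_eq0 y0; exact: val_inj. Qed.

HB.instance Definition _ :=
  Lmodule_isNormed.Build R sub_space sub_normD sub_normZ sub_norm0_eq0.

End sub_space.
Arguments sub_val {R X Y} _.
Arguments sub_valP {R X Y} _.

Section sub_space_complete.
Context {R : realType} (X : completeNormedModType R) (Y : closed_subspace X).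

Fact sub_space_complete (F : set_system (sub_space Y)) :
  ProperFilter F -> cauchy F -> cvg F.
Proof.
move=> FF /cauchyP Fc.
have PF : ProperFilter (sub_val @ F) by exact: fmap_proper_filter.
have /cauchy_cvg/cvg_ex[/= x Fx] : cauchy (sub_val @ F).
  apply/cauchyP => e e0; have [y Fy] := Fc _ e0.
  by exists (sub_val y); move: Fy; rewrite -!ball_normE.
have xY : x \in Y.
  apply: (@closed_cvg _ _ F _ sub_val (fun z => z \in Y) _ _ x Fx).
    exact: closed_submodP.
  by apply: nearW => y; exact: sub_valP.
apply/cvg_ex; exists (SubSpace xY); apply/cvgrPdist_lt => e e0.
by have /cvgrPdist_lt/(_ _ e0) := Fx.
Qed.

HB.instance Definition _ :=
  Uniform_isComplete.Build (sub_space Y) sub_space_complete.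

End sub_space_complete.


Section lmod_quot.
Context {K : pzRingType} {V : lmodType K} (S : submodule V).
Local Open Scope quotient_scope.

Definition lmod_quot : Type := Quotient.quot S.
HB.instance Definition _ := Choice.on lmod_quot.
HB.instance Definition _ := Quotient.on lmod_quot.
HB.instance Definition _ := GRing.Zmodule.on lmod_quot.

Definition quot_proj (x : V) : lmod_quot := \pi_(lmod_quot) x.

Lemma quot_projP x y : quot_proj x = quot_proj y <-> x - y \in S.
Proof.
by rewrite [x - y \in S]Quotient.idealrBE; split=> [/eqP|/eqP].
Qed.

Lemma quot_projD x y : quot_proj (x + y) = quot_proj x + quot_proj y.
Proof. by rewrite /quot_proj !piE. Qed.

Definition quot_scale (a : K) (q : lmod_quot) : lmod_quot :=
  quot_proj (a *: repr q).

Lemma quot_scaleE a x : quot_scale a (quot_proj x) = quot_proj (a *: x).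
Proof.
apply/quot_projP; rewrite -scalerBr rpredZ//; apply/quot_projP.
by rewrite /quot_proj reprK.
Qed.

Lemma quot_projK q : quot_proj (repr q) = q.
Proof. by rewrite /quot_proj reprK. Qed.

Lemma quot_proj_surj q : exists x, quot_proj x = q.
Proof. by exists (repr q); exact: quot_projK. Qed.

Fact quot_scaleA a b q : quot_scale a (quot_scale b q) = quot_scale (a * b) q.
Proof. by rewrite -(quot_projK q) !quot_scaleE scalerA. Qed.

Fact quot_scale1 : left_id 1 quot_scale.
Proof. by move=> q; rewrite -(quot_projK q) quot_scaleE scale1r. Qed.

Fact quot_scaleDr : right_distributive quot_scale +%R.
Proof.
move=> a p q; rewrite -(quot_projK p) -(quot_projK q) -quot_projD !quot_scaleE.
by rewrite scalerDr quot_projD.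
Qed.

Fact quot_scaleDl q : {morph quot_scale^~ q : a b / a + b}.
Proof.
by move=> a b; rewrite -(quot_projK q) !quot_scaleE scalerDl quot_projD.
Qed.

HB.instance Definition _ := GRing.Zmodule_isLmodule.Build K lmod_quot
  quot_scaleA quot_scale1 quot_scaleDr quot_scaleDl.

Fact quot_proj_linear : linear quot_proj.
Proof. by move=> a x y; rewrite quot_projD -quot_scaleE. Qed.

HB.instance Definition _ :=
  GRing.isLinear.Build K V lmod_quot *:%R quot_proj quot_proj_linear.

Lemma quot_proj0 x : quot_proj x = 0 <-> x \in S.
Proof. by rewrite -(linear0 quot_proj) quot_projP subr0. Qed.

End lmod_quot.

Section quot_space.
Context {R : realType} (X : normedModType R) (Z : closed_subspace X).

Definition quot_space : Type := lmod_quot Z.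
HB.instance Definition _ := GRing.Lmodule.on quot_space.

Definition quot_map : {linear X -> quot_space} := @quot_proj R X Z.

Definition quot_norm (q : quot_space) : R :=
  inf [set `|x| | x in [set x | quot_map x = q]].

Lemma quot_norm_has_inf q :
  has_inf [set `|x| | x in [set x | quot_map x = q]].
Proof.
have [x xq] := @quot_proj_surj R X Z q.
by split; [exists `|x|, x|exists 0 => _ [y _ <-]].
Qed.

Lemma quot_norm_ge0 q : 0 <= quot_norm q.
Proof.
by apply: lb_le_inf; [case: (quot_norm_has_inf q)|move=> _ [y _ <-]].
Qed.

Lemma quot_norm_map x : quot_norm (quot_map x) <= `|x|.
Proof. by apply: ge_inf; [case: (quot_norm_has_inf (quot_map x))|exists x]. Qed.

Lemma quot_norm_lift q e : quot_norm q < e -> exists2 x, quot_map x = q & `|x| < e.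
Proof.
rewrite -subr_gt0 => /inf_adherent/(_ (quot_norm_has_inf q))[_ [x xq <-]].
by rewrite addrC subrK => xe; exists x.
Qed.

Fact quot_normD p q : quot_norm (p + q) <= quot_norm p + quot_norm q.
Proof.
apply/ler_addgt0Pr => e e0.
have e2 : 0 < e / 2 by rewrite divr_gt0.
have [x <- xe] : exists2 x, quot_map x = p & `|x| < quot_norm p + e / 2.
  by apply: quot_norm_lift; rewrite ltrDl.
have [y <- ye] : exists2 y, quot_map y = q & `|y| < quot_norm q + e / 2.
  by apply: quot_norm_lift; rewrite ltrDl.
rewrite -linearD (le_trans (quot_norm_map _))// (le_trans (ler_normD _ _))//.
by rewrite (splitr e) addrACA lerD// ltW.
Qed.

Fact quot_normZ a q : quot_norm (a *: q) = `|a| * quot_norm q.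
Proof.
have le b p : quot_norm (b *: p) <= `|b| * quot_norm p.
  apply/ler_addgt0Pr => e e0.
  have b0 : 0 < `|b| + 1 by rewrite ltr_wpDl.
  have [x <- xe] : exists2 x, quot_map x = p & `|x| < quot_norm p + e / (`|b| + 1).
    by apply: quot_norm_lift; rewrite ltrDl divr_gt0.
  rewrite -linearZ (le_trans (quot_norm_map _))// normrZ.
  apply: (le_trans (ler_wpM2l _ (ltW xe))) => //.
  rewrite mulrDr lerD2l mulrCA ler_piMr ?(ltW e0)//.
  by rewrite ler_pdivrMr// mul1r lerDl.
apply/eqP; rewrite eq_le le/=.
have [->|a0] := eqVneq a 0; first by rewrite normr0 mul0r quot_norm_ge0.
rewrite -ler_pdivlMl ?normr_gt0// -normfV.
by have := le a^-1 (a *: q); rewrite scalerA mulVf// scale1r.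
Qed.

Fact quot_norm0_eq0 q : quot_norm q = 0 -> q = 0.
Proof.
have [x <- {q}] := @quot_proj_surj R X Z q => x0.
apply/quot_proj0.
apply: (@closed_submodP _ _ Z) => B /nbhs_ballP[e /= e0 xB].
have [y yx ye] : exists2 y, quot_map y = quot_map x & `|y| < e.
  by apply: quot_norm_lift; rewrite x0.
exists (x - y); split.
  by apply/quot_projP; rewrite [RHS]yx.
by apply: xB; rewrite -ball_normE /ball_/= opprB addrC subrK.
Qed.

HB.instance Definition _ :=
  Lmodule_isNormed.Build R quot_space quot_normD quot_normZ quot_norm0_eq0.

End quot_space.

Section quot_space_complete.
Context {R : realType} (X : completeNormedModType R) (Z : closed_subspace X).

Fact quot_space_complete (F : set_system (quot_space Z)) :
  ProperFilter F -> cauchy F -> cvg F.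
Proof.
move=> FF /cauchyP Fc.
have h0 n : 0 < (2^-1 : R) ^+ n by rewrite exprn_gt0.
have /choice[q Fq] : forall n, exists q, F (ball q (2^-1 ^+ n)).
  by move=> n; exact: Fc.
have /choice[u uP] : forall n, exists x,
    quot_map Z x = q n.+1 - q n /\ `|x| < geometric 2 2^-1 n.
  move=> n; have [t [/=]] := @filter_ex _ F _ _ (filterI (Fq n) (Fq n.+1)).
  rewrite -!ball_normE /ball_/= => nt n1t.
  have : quot_norm (q n.+1 - q n) < geometric 2 2^-1 n.
    rewrite -[quot_norm _]/(`|q n.+1 - q n|) -(subrKA t).
    rewrite (le_lt_trans (ler_normD _ _))//= mulr_natl mulr2n ltrD//.
      by rewrite (lt_le_trans n1t)// exprS ler_piMl ?(ltW (h0 n))// invf_le1// ler1n.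
    by rewrite distrC.
  by move=> /quot_norm_lift[x xq xlt]; exists x.
have ucvg : cvgn (series u).
  apply: normed_cvg; apply: (@series_le_cvg _ _ (geometric 2 2^-1)).
  - by move=> n; exact: normr_ge0.
  - by move=> n; rewrite mulr_ge0// ltW.
  - by move=> n; exact: ltW (uP n).2.
  - by apply: is_cvg_geometric_series; rewrite ger0_norm ?invr_ge0// invf_lt1// ltr1n.
have qE n : quot_map Z (series u n) = q n - q 0%N.
  elim: n => [|n IH]; first by rewrite seriesEnat/= big_geq// linear0 subrr.
  by rewrite -[series u n.+1](subrK (series u n)) -/(series u n) seriesSB linearD
    IH (uP n).1 addrA subrK.
have [x0 x0q] := @quot_proj_surj R X Z (q 0%N).
apply/cvg_ex; exists (quot_map Z (limn (series u) + x0)).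
apply/cvgrPdist_lt => e e0.
have e2 : 0 < e / 2 by rewrite divr_gt0.
have /cvgrPdist_lt/(_ _ e2) uN := ucvg.
have /cvgrPdist_lt/(_ _ e2) gN : (2^-1 : R) ^+ n @[n --> \oo] --> (0 : R).
  by apply: cvg_expr; rewrite ger0_norm ?invr_ge0// invf_lt1// ltr1n.
have [n [/= un gn]] := @filter_ex _ \oo _ _ (filterI uN gN).
apply: filterS (Fq n) => t; rewrite -ball_normE /ball_/= => qt.
rewrite -(subrKA (q n)) (le_lt_trans (ler_normD _ _))// (splitr e) ltrD//.
  have -> : quot_map Z (limn (series u) + x0) - q n =
            quot_map Z (limn (series u) - series u n).
    rewrite linearB qE linearD -[quot_map Z x0]/(quot_proj Z x0) x0q.
    by rewrite opprB addrA.
  by apply: (le_lt_trans _ un); exact: quot_norm_map.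
by rewrite (lt_trans qt)//; move: gn; rewrite sub0r normrN ger0_norm// ltW.
Qed.

HB.instance Definition _ :=
  Uniform_isComplete.Build (quot_space Z) quot_space_complete.

End quot_space_complete.

(* Y / Z as a closed subspace of X / Z. Closedness is where [Z <= Y] is used. *)
Section quot_subspace.
Context {R : realType} {X : normedModType R} (Z Y : closed_subspace X).
Hypothesis ZY : {subset Z <= Y}.

Let quot_subspace_pred : {pred quot_space Z} :=
  mem (quot_map Z @` [set y | y \in Y]).

Let quot_subspaceP : submod_closed quot_subspace_pred.
Proof.
split; first by rewrite inE; exists 0; [exact: rpred0|exact: linear0].
move=> a p q; rewrite !inE => -[x xY <-] [y yY <-].
by exists (a *: x + y); [rewrite /= rpredD// rpredZ|rewrite linearP].
Qed.

Let quot_subspace_closed : closed [set q | q \in quot_subspace_pred].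
Proof.
move=> q clq; have [x xq] := @quot_proj_surj R X Z q.
rewrite /= inE; exists x => //.
apply: (@closed_submodP _ _ Y) => B /nbhs_ballP[e /= e0 xB].
have /clq[p /= [+ qp]] : nbhs q (ball q e) by exact: nbhsx_ballx.
rewrite inE => -[y yY yp].
move: qp; rewrite -ball_normE /ball_/= -xq -yp => xye.
have [w wq we] : exists2 w, quot_map Z w = quot_map Z (x - y) & `|w| < e.
  by apply: quot_norm_lift; rewrite linearB.
exists (x - w); split.
  have : x - y - w \in Z by apply/quot_projP; rewrite [RHS]wq.
  move=> /ZY xywY; have -> : x - w = x - y - w + y by rewrite addrAC subrK.
  exact: rpredD.
by apply: xB; rewrite -ball_normE /ball_/= opprB addrC subrK.
Qed.

Definition quot_subspace : closed_subspace (quot_space Z) :=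
  ClosedSubspace (closed_submod := Submodule quot_subspaceP) quot_subspace_closed.

End quot_subspace.

Section annihilator.
Context {R : realType} {X : normedModType R} (Y : closed_subspace X).

Let annihilator_pred : {pred dual X} :=
  mem [set f : dual X | forall y, y \in Y -> f y = 0].

Let annihilatorP : submod_closed annihilator_pred.
Proof.
split; first by rewrite inE.
move=> a f g; rewrite !inE => fY gY y yY.
by rewrite -[LHS]/(a *: f y + g y) fY// gY// scaler0 addr0.
Qed.

Let annihilator_closed : closed [set f | f \in annihilator_pred].
Proof.
move=> f clf; rewrite /= inE => y yY; apply/normr0_eq0/le_anti.
rewrite normr_ge0 andbT; apply/ler_addgt0Pr => e e0; rewrite add0r.
have y0 : 0 < `|y| + 1 by rewrite ltr_wpDl.
have /clf[g /= []] : nbhs f (ball f (e / (`|y| + 1))).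
  by apply: nbhsx_ballx; rewrite divr_gt0.
rewrite inE => gY; rewrite -ball_normE /ball_/= => fg.
have -> : f y = (f - g) y by rewrite -[RHS]/(f y - g y) gY// subr0.
rewrite (le_trans (dual_norm_ub _ _))//.
rewrite (le_trans (ler_wpM2r _ (ltW fg)))// mulrAC ler_pdivrMr// ler_wpM2l//.
  exact: ltW.
by rewrite lerDl.
Qed.

Definition annihilator : closed_subspace (dual X) :=
  ClosedSubspace (closed_submod := Submodule annihilatorP) annihilator_closed.

End annihilator.

(* [LspaceType] carries no vector space structure, so L1 is built here as the
   quotient of the library's space of functions with finite 1-norm by the
   almost everywhere null ones. The norm does not depend on the representative
   (L1_normE). *)
Section L1.
Context {R : realType} {d : measure_display} {T : measurableType d}.
Variable mu : {measure set T -> \bar R}.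

Local Notation Lfun1 := (LfunType mu (@lexx _ _ 1%E)).

Let null_pred : {pred Lfun1} := mem [set f : Lfun1 | f = 0 %[ae mu]].

Let null_predP : submod_closed null_pred.
Proof.
split; first by rewrite inE; exact: ae_eq_refl.
move=> a f g; rewrite !inE /= => f0 g0.
apply: filterS2 f0 g0 => x /(_ I) fx /(_ I) gx _.
by rewrite -[LHS]/(a * f x + g x) fx gx mulr0 addr0.
Qed.

Definition null_fun : submodule Lfun1 := Submodule null_predP.

Definition L1 : Type := lmod_quot null_fun.
HB.instance Definition _ := GRing.Lmodule.on L1.

Definition L1_class : {linear Lfun1 -> L1} := @quot_proj R Lfun1 null_fun.

Definition L1_norm (q : L1) : R := fine 'N[mu]_1[EFin \o (repr q : Lfun1)].

Lemma L1_normE (f : Lfun1) : L1_norm (L1_class f) = fine 'N[mu]_1[EFin \o f].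
Proof.
have le (g h : Lfun1) : g - h \in null_fun ->
    fine 'N[mu]_1[EFin \o g] <= fine 'N[mu]_1[EFin \o h].
  rewrite inE /= => gh0.
  rewrite -[g in leLHS](subrK h) (le_trans (ler_LnormD _ _))//.
  rewrite gerDr Lnorm1 (_ : integral _ _ _ = 0%E)//.
  apply/ae_eq_integral_abs => //; first exact/measurable_EFinP.
  by apply: filterS gh0 => x /(_ I) /= gh _; rewrite gh.
have /quot_projP e := quot_projK (L1_class f).
apply/eqP; rewrite eq_le !le//.
by rewrite -opprB rpredN.
Qed.

Fact L1_normD p q : L1_norm (p + q) <= L1_norm p + L1_norm q.
Proof.
rewrite -(quot_projK p) -(quot_projK q) -[quot_proj _ _ + _]linearD.
by rewrite !L1_normE; exact: ler_LnormD.
Qed.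

Fact L1_normZ a q : L1_norm (a *: q) = `|a| * L1_norm q.
Proof.
rewrite -(quot_projK q) -[a *: _]linearZ !L1_normE.
apply: EFin_inj; rewrite EFinM !finite_norm_fine -LnormZ.
by [].
Qed.

Fact L1_norm0_eq0 q : L1_norm q = 0 -> q = 0.
Proof.
by move=> /fine_Lnormr_eq0 q0; rewrite -(quot_projK q); apply/quot_proj0; rewrite inE.
Qed.

HB.instance Definition _ :=
  Lmodule_isNormed.Build R L1 L1_normD L1_normZ L1_norm0_eq0.

End L1.

Lemma mem_quot_subspace {R : realType} {X : normedModType R}
    (Z Y : closed_subspace X) (ZY : {subset Z <= Y}) (q : quot_space Z) :
  q \in quot_subspace ZY <-> exists2 y, y \in Y & quot_map Z y = q.
Proof. by rewrite inE. Qed.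

Lemma mem_annihilator {R : realType} {X : normedModType R}
    (Y : closed_subspace X) (f : dual X) :
  f \in annihilator Y <-> forall y, y \in Y -> f y = 0.
Proof. by rewrite inE. Qed.

Definition complementary {R : realType} {V : normedModType R}
    (G W : closed_subspace V) : Prop :=
  (forall v, v \in G -> v \in W -> v = 0) /\
  (forall v, exists g h, [/\ g \in G, h \in W & v = g + h]).

Definition property_SU {R : realType} {X : completeNormedModType R}
    (Y : closed_subspace X) : Prop :=
  exists G : closed_subspace (dual X),
    complementary G (annihilator Y) /\
    forall f g h : dual X, g \in G -> h \in annihilator Y -> f = g + h ->
      h != 0 -> `|f| > `|g|.

Definition L_summand {R : realType} {V : normedModType R}
    (W : closed_subspace V) : Prop :=
  exists P : {linear V -> V},
    [/\ forall v, P (P v) = P v,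
        range P = [set v | v \in W] &
        forall v, `|v| = `|P v| + `|v - P v|].

Definition M_ideal {R : realType} {Y : completeNormedModType R}
    (J : closed_subspace Y) : Prop :=
  L_summand (annihilator J).

Definition isometrically_isomorphic {R : realType}
    (V W : normedModType R) : Prop :=
  exists T : {linear V -> W}, bijective T /\ forall v, `|T v| = `|v|.

Definition L1_predual {R : realType} (X : completeNormedModType R) : Prop :=
  exists (d : measure_display) (T : measurableType d)
      (mu : {measure set T -> \bar R}),
    isometrically_isomorphic (dual X) (L1 mu).

(* Main.v *)
Require Import Defs.
From HB Require Import structures.
From mathcomp Require Import all_boot all_order all_algebra.
From mathcomp Require Import all_classical all_reals all_analysis measurable_realfun.
From mathcomp Require Import ring lra.

Set Implicit Arguments.
Unset Strict Implicit.
Unset Printing Implicit Defensive.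

Import Order.TTheory GRing.Theory Num.Theory.
Import numFieldNormedType.Exports.

Local Open Scope classical_set_scope.
Local Open Scope ring_scope.

(** (a) Composition with the quotient map identifies [(X/Z)^*] with the
    annihilator of [Z], isometrically. If [f = g + h] vanishes on [Z], so does
    [h] (as [Z <= Y]), hence so does [g]: the trace of [G] on this annihilator
    is the required complement.

    (b) By Hahn-Banach, property-SU provides an isometric linear extension
    operator [E : Y^* -> X^*] with range [G]. Let [P] be the L-projection of
    [Y^*] onto the annihilator of [J], which is isometric to [(Y/J)^*]. On
    [X^* = L1(mu)] the operator [Q f = E (P (f restricted to Y))] is a
    contraction which is strict off its fixed points, and its fixed space is
    isometric to [(Y/J)^*]. So the general theorem on ranges of contractive
    projections in L1 is not needed: if [f] is fixed and [0 <= a <= 1], the norm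
    is additive on [f = a f + (1 - a) f], so strictness makes [a f] fixed. The
    fixed space is therefore a band, and it is [L1(nu)] for the measure [nu]
    that agrees with [mu] on the sigma-ideal of sets [A] such that the band
    contains all integrable functions supported in [A], and that is infinite on
    all other sets. *)

(** * Hahn-Banach theorem *)

Section hahn_banach.
Context {R : realType} (V : lmodType R) (p : V -> R).
Hypothesis pD : forall x y, p (x + y) <= p x + p y.
Hypothesis pZ : forall a x, 0 <= a -> p (a *: x) = a * p x.

Let linear_graph (G : set (V * R^o)) :=
  forall a u v, G u -> G v -> G (a *: u + v).
Let dominated_graph (G : set (V * R^o)) := forall u, G u -> u.2 <= p u.1.

Let graph0 G u : linear_graph G -> G u -> G 0.
Proof. by move=> lG Gu; rewrite -(addNr u) -scaleN1r; exact: lG. Qed.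

Let graphZ G a u : linear_graph G -> G u -> G (a *: u).
Proof. by move=> lG Gu; rewrite -[_ *: _]addr0; exact: (lG _ _ _ Gu (graph0 lG Gu)). Qed.

(* The sup over the graph of [r - p (x - z)] is below the inf of
   [p (y + z) - s], by subadditivity. *)
Let extension_value G z : G !=set0 -> linear_graph G -> dominated_graph G ->
  exists c, forall x r, G (x, r) -> r + c <= p (x + z) /\ r - c <= p (x - z).
Proof.
move=> [u0 Gu0] lG dG.
pose B := [set a | exists u : V * R^o, G u /\ a = u.2 - p (u.1 - z)].
have ubB u : G u -> ubound B (p (u.1 + z) - u.2).
  move=> Gu _ [v [Gv ->]]; rewrite lerBrDr addrAC lerBlDr.
  have := dG _ (lG 1 _ _ Gv Gu); rewrite scale1r/= => /le_trans; apply.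
  have -> : v.1 + u.1 = (u.1 + z) + (v.1 - z) by rewrite addrACA subrr addr0 addrC.
  exact: pD.
have supB : has_sup B.
  by split; [exists (u0.2 - p (u0.1 - z)), u0|exists (p (u0.1 + z) - u0.2); exact: ubB].
exists (sup B) => x r Gxr; split.
  rewrite addrC -lerBrDr; apply: ge_sup; first by case: supB.
  exact: (ubB (x, r)).
rewrite lerBlDr addrC -lerBlDr.
by apply: sup_upper_bound => //; exists (x, r).
Qed.

(** The new graph adds the line through [(z, c)]. A point with coefficient [a != 0] along this line
    is divided by [|a|], which reduces domination to one of the two inequalities for [c], depending
    on the sign of [a]. *)
Let extend G z : G !=set0 -> linear_graph G -> dominated_graph G ->
  exists H, [/\ linear_graph H, dominated_graph H, G `<=` H & exists c, H (z, c)].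
Proof.
move=> G0 lG dG; have [c cP] := extension_value z G0 lG dG.
exists [set u | exists a : R, G (u - a *: (z, c))]; split.
- move=> a u v [b Gu] [b' Gv]; exists (a * b + b').
  rewrite scalerDl opprD -scalerA addrACA -scalerBr.
  exact: lG.
- move=> [x r] [a]; rewrite /dominated_graph/=.
  have kE k : k *: (((x, r) : V * R^o) - a *: ((z, c) : V * R^o)) =
      (k *: (x - a *: z), k * (r - a * c)) by [].
  have [a0|a0|->] := ltgtP a 0.
  + move=> /(graphZ (- a^-1) lG); rewrite kE => /cP[_].
    have na : 0 < - a^-1 by rewrite oppr_gt0 invr_lt0.
    have -> : - a^-1 *: (x - a *: z) - z = - a^-1 *: x.
      by rewrite scalerBr scalerA mulNr mulVf ?lt_eqF// scaleN1r opprK addrK.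
    have -> : - a^-1 * (r - a * c) = - a^-1 * r + c by field; rewrite lt_eqF.
    by rewrite addrK pZ ?(ltW na)// ler_pM2l.
  + move=> /(graphZ a^-1 lG); rewrite kE => /cP[+ _].
    have na : 0 < a^-1 by rewrite invr_gt0.
    have -> : a^-1 *: (x - a *: z) + z = a^-1 *: x.
      by rewrite scalerBr scalerA mulVf ?gt_eqF// scale1r subrK.
    have -> : a^-1 * (r - a * c) = a^-1 * r - c by field; rewrite gt_eqF.
    by rewrite subrK pZ ?(ltW na)// ler_pM2l.
  + by rewrite scale0r subr0 => /dG.
- by move=> u Gu; exists 0; rewrite scale0r subr0.
- exists c, 1; rewrite scale1r subrr; case: G0 => u; exact: graph0.
Qed.

Lemma hahn_banach (G : set (V * R^o)) : G !=set0 ->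
  (forall a u v, G u -> G v -> G (a *: u + v)) ->
  (forall u, G u -> u.2 <= p u.1) ->
  exists F : {linear V -> R^o},
    (forall u, G u -> F u.1 = u.2) /\ forall x, F x <= p x.
Proof.
move=> [u0 Gu0] lG dG.
(* Containing [G] is demanded only of nonempty [H], since the union of the empty chain must satisfy
   [P] too. Maximality then excludes the empty graph. *)
pose P (H : set (V * R^o)) := [/\ linear_graph H, dominated_graph H &
  forall u, H u -> G `<=` H].
have [F FP Ftot|A [[lA dA GA] Amax]] := @Zorn_bigcup _ P.
  split.
  - move=> a u v [H FH Hu] [K FK Kv].
    have [HK|KH] := Ftot _ _ FH FK.
      by exists K => //; case: (FP _ FK) => lK _ _; apply: lK => //; exact: HK.
    by exists H => //; case: (FP _ FH) => lH _ _; apply: lH => //; exact: KH.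
  - by move=> u [H /FP[_ + _]]; exact.
  - move=> u [H FH Hu] v Gv; exists H => //.
    by case: (FP _ FH) => _ _ /(_ _ Hu); exact.
have A0 : A !=set0.
  apply: contrapT => /nonemptyPn A0.
  apply: (Amax G); last by split=> // u _.
  by split; [rewrite A0|move=> /(_ _ Gu0); rewrite A0].
have {}GA : G `<=` A by case: A0 => u /GA.
have Atot x : exists r, A (x, r).
  have [B [lB dB AB [c Bc]]] := extend x A0 lA dA.
  exists c; apply: contrapT => nAc; apply: (Amax B).
    by split=> // /(_ _ Bc).
  by split=> // u Bu; exact: subset_trans AB.
(* Two values over [x] differ by a value over [0], which domination bounds by [p 0 = 0]. *)
have Auniq x r s : A (x, r) -> A (x, s) -> r = s.
  suff le r' s' : A (x, r') -> A (x, s') -> r' <= s'.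
    by move=> Ar As; apply/le_anti; rewrite !le.
  move=> Ar As; have := dA _ (lA (-1) _ _ As Ar).
  rewrite scaleN1r/= addNr.
  have -> : p 0 = 0 by rewrite -(scale0r 0) pZ// mul0r.
  by rewrite addrC subr_le0.
have [f fA] := choice Atot.
have lf : linear f.
  move=> a x y; apply: (Auniq (a *: x + y)) => //.
  exact: (lA a _ _ (fA x) (fA y)).
pose F : {linear V -> R^o} :=
  HB.pack f (GRing.isLinear.Build R V R^o *:%R f lf).
exists F; split => [[x r] /GA Axr|x] /=.
  exact: (Auniq x).
exact: (dA _ (fA x)).
Qed.

End hahn_banach.

(** * Bounded functionals and norm-preserving extension *)

Section dual_theory.
Context {R : realType}.
Implicit Types X V W : normedModType R.

Lemma bounded_dual X (f : {linear X -> R^o}) (c : R) : 0 <= c ->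
  (forall x, `|f x| <= c * `|x|) ->
  exists2 F : dual X, (forall x, F x = f x) & `|F| <= c.
Proof.
move=> c0 fc.
have fP : (f : X -> R^o) \in dual_pred X.
  rewrite inE; split; first exact: linearP.
  apply/linear_bounded_continuous/bounded_funP => r; exists (c * r) => x xr.
  by rewrite (le_trans (fc x))// ler_wpM2l.
exists (Dual fP) => //; apply: dual_norm_le => x x1.
by rewrite (le_trans (fc x))// ler_piMr.
Qed.

Lemma eq_dual X (f g : dual X) : f =1 g -> f = g.
Proof. by move=> fg; exact/val_inj/funext. Qed.

(** Hahn-Banach for the sublinear functional [|f| * |x|] and the graph of [f]. The one-sided bound,
    taken at [- x], gives the other side. *)
Lemma dual_norm_ext X (Y : closed_subspace X) (f : dual (sub_space Y)) :
  exists2 F : dual X, (forall y : sub_space Y, F (sub_val y) = f y) & `|F| <= `|f|.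
Proof.
have [|||||F [Ff Fp]] := @hahn_banach R X (fun x => `|f| * `|x|) _ _
    [set (sub_val y, f y) | y in [set: sub_space Y]].
- by move=> x y; rewrite -mulrDr ler_wpM2l// ler_normD.
- by move=> a x a0; rewrite normrZ ger0_norm// mulrCA.
- by exists (sub_val (0 : sub_space Y), f 0), 0.
- by move=> a _ _ [x _ <-] [y _ <-]; exists (a *: x + y) => //; rewrite linearP.
- by move=> _ [y _ <-] /=; rewrite (le_trans (ler_norm _))// dual_norm_ub.
have [|G GF Gf] := @bounded_dual X F `|f| (normr_ge0 _).
  move=> x; rewrite ler_norml Fp andbT lerNl -linearN.
  by rewrite -(normrN x) Fp.
by exists G => // y; rewrite GF (Ff (sub_val y, f y))//; exists y.
Qed.

Lemma dual_precomp V W (A : {linear V -> W}) (f : dual W) :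
  (forall v, `|A v| <= `|v|) ->
  exists2 F : dual V, (forall v, F v = f (A v)) & `|F| <= `|f|.
Proof.
move=> A1.
have [|F FE FN] := @bounded_dual V (f \o A : {linear V -> R^o}) `|f| (normr_ge0 _).
  move=> v; apply: (le_trans (dual_norm_ub _ _)).
  exact: (ler_wpM2l (normr_ge0 f) (A1 v)).
by exists F.
Qed.

End dual_theory.

(** * Classes of integrable functions *)

(** The power [-1] given by [powR] is the inverse on nonnegative reals, hence the square; at [0]
    both sides are [0]. *)
Lemma measurable_inv (R : realType) : measurable_fun setT (GRing.inv : R -> R).
Proof.
rewrite (_ : GRing.inv = fun x : R => x * powR (x * x) (-1)).
  apply: measurable_funM => //; apply: measurableT_comp (measurable_powR _) _.
  exact: measurable_funM.
apply/funext => x; rewrite powR_inv1 ?sqr_ge0//.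
have [->|x0] := eqVneq x 0; first by rewrite invr0 mul0r.
by field.
Qed.

Section L1_class_of.
Context {R : realType} {d : measure_display} {T : measurableType d}.
Variable mu : {measure set T -> \bar R}.
Implicit Types (f g : T -> R) (A : set T).

Local Notation Lfun1 := (LfunType mu (@lexx _ _ 1%E)).
Local Notation integrable1 f := (mu.-integrable setT (EFin \o f)).

Lemma integrable1_linear c f g : integrable1 f -> integrable1 g ->
  integrable1 (fun x => c * f x + g x).
Proof.
move=> intf intg.
rewrite (_ : _ \o _ = (fun x => c%:E * (f x)%:E) \+ (EFin \o g))%E//.
by apply: integrableD => //; apply: integrableZl.
Qed.

Lemma le_integrable1 f g : measurable_fun setT f -> integrable1 g ->
  (forall x, `|f x| <= `|g x|) -> integrable1 f.
Proof.
move=> mf intg fg; apply: le_integrable intg => //.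
  exact/measurable_EFinP.
by move=> x _ /=; rewrite lee_fin.
Qed.

Lemma integrable1_measurable f : integrable1 f -> measurable_fun setT f.
Proof. by move=> /integrableP[/measurable_EFinP]. Qed.

Lemma integrable1_indic A f : measurable A -> integrable1 f ->
  integrable1 (fun x => \1_A x * f x).
Proof.
move=> mA intf; apply: (le_integrable1 _ intf).
  by apply: measurable_funM; [exact: measurable_indic|exact: integrable1_measurable].
move=> x; rewrite normrM indicE ger0_norm// ler_piMl//.
by case: (x \in A).
Qed.

(* Junk value: the class of [0] when [f] is not integrable. *)
Definition L1_of f : L1 mu := L1_class mu (insubd (0 : Lfun1) f).

Lemma insubd_LfunE f : integrable1 f -> val (insubd (0 : Lfun1) f) = f.
Proof. by move=> /Lfun1_integrable fP; rewrite insubdK. Qed.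

Lemma L1_of_linear a f g : integrable1 f -> integrable1 g ->
  L1_of (fun x => a * f x + g x) = a *: L1_of f + L1_of g.
Proof.
move=> intf intg; rewrite /L1_of -linearP; congr (L1_class _ _).
apply: val_inj; rewrite insubd_LfunE; last exact: integrable1_linear.
by rewrite -[in LHS](insubd_LfunE intf) -[in LHS](insubd_LfunE intg).
Qed.

Lemma norm_L1_of f : integrable1 f -> (`|L1_of f|%:E = \int[mu]_x `|(f x)%:E|)%E.
Proof.
move=> intf; rewrite [`|_|]L1_normE finite_norm_fine Lnorm1.
by rewrite -[in RHS](insubd_LfunE intf).
Qed.

Lemma L1_of_repr (q : L1 mu) : L1_of (val (repr q : Lfun1)) = q.
Proof. by rewrite /L1_of valKd; exact: quot_projK. Qed.

Lemma integrable_Lfun1 (f : Lfun1) : integrable1 (val f).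
Proof. exact/Lfun1_integrable/LfunP. Qed.

Lemma L1_ofP f g : integrable1 f -> integrable1 g ->
  L1_of f = L1_of g <-> f = g %[ae mu].
Proof.
move=> intf intg; rewrite -[in X in _ <-> X](insubd_LfunE intf).
rewrite -[in X in _ <-> X](insubd_LfunE intg).
apply: (iff_trans (quot_projP _ _ _)); rewrite inE /=.
split; apply: filterS => x /(_ I) fg _.
  by apply/eqP; rewrite -subr_eq0; exact/eqP.
rewrite -[LHS]/(val (insubd (0 : Lfun1) f) x - val (insubd (0 : Lfun1) g) x).
by apply/eqP; rewrite subr_eq0; exact/eqP.
Qed.

End L1_class_of.

(** * Fixed points of strict contractions of L1 *)

Section fixed_points.
Context {R : realType} {d : measure_display} {T : measurableType d}.
Variable mu : {measure set T -> \bar R}.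
Implicit Types (f g a : T -> R) (A B : set T).

Local Notation integrable1 f := (mu.-integrable setT (EFin \o f)).

Variable Q : {linear L1 mu -> L1 mu}.
Hypothesis Qle : forall q, `|Q q| <= `|q|.
Hypothesis Qeq : forall q, `|Q q| = `|q| -> Q q = q.

Let fixed f := integrable1 f /\ Q (L1_of mu f) = L1_of mu f.

Let fixed_linear c f g : fixed f -> fixed g -> fixed (fun x => c * f x + g x).
Proof.
move=> [intf Qf] [intg Qg]; split; first exact: integrable1_linear.
by rewrite L1_of_linear// linearP Qf Qg.
Qed.

(* With [g = a f], the norm is additive on [f = g + (f - g)], so contractivity
   on both terms forces [`|Q g| = `|g|]. *)
Let fixed_mul01 a f : measurable_fun setT a -> (forall x, 0 <= a x <= 1) ->
  fixed f -> fixed (fun x => a x * f x).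
Proof.
move=> ma a01 [intf Qf].
have mf := integrable1_measurable intf.
have intg : integrable1 (fun x => a x * f x).
  apply: (le_integrable1 _ intf); first exact: measurable_funM.
  move=> x; have /andP[a0 a1] := a01 x.
  by rewrite normrM ger0_norm// ler_piMl.
split => //; apply: Qeq; apply/le_anti; rewrite Qle/=.
pose h x := (-1) * (a x * f x) + f x.
have inth : integrable1 h by exact: integrable1_linear.
have fgh : L1_of mu f = L1_of mu (fun x => a x * f x) + L1_of mu h.
  by rewrite /h L1_of_linear// scaleN1r addrA subrr add0r.
have nfgh : `|L1_of mu f| = `|L1_of mu (fun x => a x * f x)| + `|L1_of mu h|.
  apply: EFin_inj; rewrite EFinD !norm_L1_of// -ge0_integralD//.
  - apply: eq_integral => x _; have /andP[a0 a1] := a01 x.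
    rewrite -EFinD; congr EFin.
    have -> : h x = (1 - a x) * f x by rewrite /h; ring.
    rewrite !normrM (ger0_norm a0) (@ger0_norm _ (1 - a x)) ?subr_ge0//; ring.
  - by apply: measurableT_comp => //; case/integrableP: intg.
  - by apply: measurableT_comp => //; case/integrableP: inth.
rewrite -(lerD2r `|L1_of mu h|) -nfgh -Qf fgh linearD.
by rewrite (le_trans (ler_normD _ _))// lerD2l.
Qed.

Let fixed_mul_bounded a f (M : R) : measurable_fun setT a ->
  (forall x, `|a x| <= M) -> fixed f -> fixed (fun x => a x * f x).
Proof.
move=> ma aM ff.
(* An affine change brings the values of [a] into [[0, 1]]: [a = 2 (|M| + 1) b - (|M| + 1)]. Adding
   [1] keeps the divisor positive. *)
pose b x := (a x / (`|M| + 1) + 1) / 2.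
have M1 : 0 < `|M| + 1 by rewrite ltr_wpDl.
have fb : fixed (fun x => b x * f x).
  apply: fixed_mul01 => //.
    by apply: measurable_funM => //; apply: measurable_funD => //; exact: measurable_funM.
  move=> x; have : `|a x / (`|M| + 1)| <= 1.
    rewrite normrM normfV (ger0_norm (ltW M1)) ler_pdivrMr// mul1r.
    by rewrite (le_trans (aM x))// (le_trans (ler_norm _))// lerDl.
  by rewrite ler_norml /b => /andP[? ?]; apply/andP; split; lra.
have f0 : fixed (fun x => (-1) * f x + f x) by exact: fixed_linear.
have := fixed_linear (2 * (`|M| + 1)) fb (fixed_linear (- (`|M| + 1)) ff f0).
congr fixed; apply/funext => x; rewrite /b; field.
by rewrite gt_eqF.
Qed.

(** Dominated convergence gives convergence in L1, and the fixed space is norm closed because [Q] is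
    a contraction. *)
Let fixed_cvg (f_ : nat -> T -> R) f g : integrable1 g ->
  (forall n, fixed (f_ n)) -> (forall n x, `|f_ n x| <= g x) ->
  (forall x, f_ n x @[n --> \oo] --> f x) -> fixed f.
Proof.
move=> intg ff_ f_g f_f.
have mf : measurable_fun setT f.
  apply: (measurable_fun_cvg (h := f_)) => //.
  by move=> n; have [/integrable1_measurable] := ff_ n.
have [|||||intf cvgf _] := @dominated_convergence _ _ _ mu setT measurableT
    (fun n => EFin \o f_ n) (EFin \o f) (EFin \o g).
- by move=> n; have [/integrableP[]] := ff_ n.
- exact/measurable_EFinP.
- by apply: nearW => x _; apply: cvg_EFin; [exact: nearW|exact: f_f].
- exact: intg.
- by apply: nearW => x n _; rewrite lee_fin.
split=> //; apply/eqP; rewrite -subr_eq0 -normr_le0.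
(* If [q] is fixed, then [Q p - p = (q - p) - Q (q - p)]. *)
have le2 n : `|Q (L1_of mu f) - L1_of mu f| <=
    2 * `|L1_of mu (fun x => (-1) * f x + f_ n x)|.
  have [intfn Qfn] := ff_ n.
  rewrite L1_of_linear// scaleN1r.
  move: (L1_of mu f) (L1_of mu (f_ n)) Qfn => p q Qq.
  have -> : Q p - p = (- p + q) - Q (- p + q).
    by rewrite linearD linearN Qq opprD opprK addrACA subrr addr0 addrC.
  by rewrite (le_trans (ler_normB _ _))// mulr_natl mulr2n lerD2l.
have cvg0 : `|L1_of mu (fun x => (-1) * f x + f_ n x)| @[n --> \oo] --> (0 : R).
  rewrite (_ : (fun n => _) = fine \o (fun n =>
    \int[mu]_x `|(EFin \o f_ n) x - (EFin \o f) x|)%E); first exact: fine_cvg.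
  apply/funext => n /=; have [intfn _] := ff_ n.
  rewrite -[LHS]/(fine `|_|%:E) norm_L1_of; last exact: integrable1_linear.
  by congr fine; apply: eq_integral => x _; rewrite mulN1r addrC.
have c2 : 2 * `|L1_of mu (fun x => (-1) * f x + f_ n x)| @[n --> \oo] --> (2 * 0 : R).
  exact: cvgM (cvg_cst _) cvg0.
rewrite mulr0 in c2; rewrite -(cvg_lim _ c2)//.
by apply: limr_ge; [apply/cvg_ex; eexists; exact: c2|exact: nearW].
Qed.


(** As [f] varies, [\1_A f] runs over the integrable functions supported in [A]. Stable sets form a
    sigma-ideal that contains the support of every fixed function. *)
Let stable A := measurable A /\
  forall f, integrable1 f -> fixed (fun x => \1_A x * f x).

Let fixed0 : fixed (fun=> 0).
Proof.
have int0 : integrable1 (fun=> 0) by exact: integrable0.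
split => //; suff -> : L1_of mu (fun=> 0) = 0 by rewrite linear0.
apply/normr0_eq0/EFin_inj; rewrite norm_L1_of//.
by under eq_integral do rewrite abse0; rewrite integral0.
Qed.

Let stable0 : stable set0.
Proof.
split=> [|f _]; first exact: measurable0.
by under eq_fun do rewrite indic0 mul0r.
Qed.

Let stableS A B : measurable B -> B `<=` A -> stable A -> stable B.
Proof.
move=> mB BA [mA sA]; split => // f intf.
have := sA _ (integrable1_indic mB intf).
congr fixed; apply/funext => x; rewrite mulrA !indicE; congr (_ * _).
have [xB|] := boolP (x \in B); last by rewrite mulr0.
by rewrite mulr1 mem_set//; apply: BA; rewrite -inE.
Qed.

Let stableU A B : stable A -> stable B -> stable (A `|` B).
Proof.
move=> [mA sA] [mB sB]; split=> [|f intf]; first exact: measurableU.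
(* The second summand is cut off outside [A], so that the overlap counts once. *)
have := fixed_linear 1 (sA _ intf)
  (sB _ (integrable1_indic (measurableC mA) intf)).
congr fixed; apply/funext => x; rewrite mul1r !indicE in_setU in_setC.
by case: (x \in A); case: (x \in B); rewrite /= ?(mul1r, mul0r, addr0, add0r).
Qed.

(** The indicators of the finite partial unions converge pointwise to that of the whole union, and
    [|f|] dominates the products. *)
Let stable_bigcup (F : (set T)^nat) : (forall n, stable (F n)) ->
  stable (\bigcup_n F n).
Proof.
move=> sF; split=> [|f intf].
  by apply: bigcupT_measurable => n; case: (sF n).
have sFn n : stable (\big[setU/set0]_(i < n) F i).
  by elim/big_ind : _ => //; exact: stableU.
apply: (@fixed_cvg (fun n x => \1_(\big[setU/set0]_(i < n) F i) x * f x)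
  _ (fun x => `|f x|)).
- apply: (le_integrable1 _ intf) => [|x]; last by rewrite normr_id.
  by apply: measurableT_comp => //; exact: integrable1_measurable intf.
- by move=> n; case: (sFn n) => _; exact.
- move=> n x; rewrite normrM indicE ger0_norm// ler_piMl//.
  by case: (x \in _).
- move=> x; apply: cvgM; last exact: cvg_cst.
  apply: cvg_near_cst.
  have [[n _ Fnx]|nF] := pselect ((\bigcup_n F n) x).
    (* The partial union up to [m] excludes the index [m], so it contains [F n] only from [m = n.+1]
       on. *)
    exists n.+1 => // m /= nm; rewrite !indicE !mem_set//; first by exists n.
    by rewrite -bigcup_mkord; exists n.
  apply: nearW => m; rewrite !indicE !memNset//.
  by apply: contra_not nF; exact: bigsetU_bigcup.
Qed.

(** On the support of [f], a given [g] is [(g / f) f]. Truncating the quotient makes it a bounded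
    multiplier of the fixed function [f], and the truncated products converge to [g] with bound
    [|g|]. *)
Let stable_supp f : fixed f -> stable [set x | f x != 0].
Proof.
move=> ff; have [/integrable1_measurable mf _] := ff.
have mS : measurable [set x | f x != 0].
  rewrite (_ : [set _ | _] = f @^-1` ~` [set 0]).
    by rewrite -[_ @^-1` _]setTI; apply: mf => //; exact: measurableC.
  by apply/seteqP; split => x /= /eqP.
split=> // g intg; have mg := integrable1_measurable intg.
pose a n x := \1_[set y | `|g y / f y| <= n%:R] x * (g x / f x).
have mgf : measurable_fun setT (fun x => g x / f x).
  by apply: measurable_funM => //; exact: (measurableT_comp (@measurable_inv R)).
have mA n : measurable [set y | `|g y / f y| <= n%:R].
  rewrite -[X in measurable X]setTI; apply: measurable_fun_le => //.
  exact: measurableT_comp.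
apply: (@fixed_cvg (fun n x => a n x * f x) _ (fun x => `|g x|)).
- apply: (le_integrable1 _ intg) => [|x]; last by rewrite normr_id.
  exact: measurableT_comp.
- move=> n; apply: (@fixed_mul_bounded _ _ n%:R) => //.
    by apply: measurable_funM => //; exact: measurable_indic.
  move=> x; rewrite /a indicE; have [|] := boolP (x \in _).
    by rewrite inE mul1r.
  by rewrite mul0r normr0.
- move=> n x; rewrite /a indicE -mulrA normrM ger0_norm//.
  rewrite (@le_trans _ _ `|g x / f x * f x|)//.
    by rewrite ler_piMl//; case: (x \in _).
  have [->|fx0] := eqVneq (f x) 0; first by rewrite mulr0 normr0.
  by rewrite divfK.
- move=> x; have [fx0|fx0] := eqVneq (f x) 0.
    rewrite indicE memNset/= ?fx0 ?eqxx// mul0r.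
    by under eq_fun do rewrite mulr0; exact: cvg_cst.
  apply: cvg_near_cst; exists (Num.truncn `|g x / f x|).+1 => // n /= gn.
  rewrite /a !indicE !mem_set//= ?mul1r ?divfK//.
  by rewrite (le_trans (ltW (truncnS_gt _)))// ler_nat.
Qed.

(* Not the restriction of [mu] to a set: the sigma-ideal of stable sets need
   not have a largest element. *)
Let nu0 A : \bar R := if `[< stable A >] then mu A else +oo%E.

Let nu0E A : stable A -> nu0 A = mu A.
Proof. by rewrite /nu0; case: asboolP. Qed.

Let nu0y A : ~ stable A -> nu0 A = +oo%E.
Proof. by rewrite /nu0; case: asboolP. Qed.

Let nu0_0 : nu0 set0 = 0%E.
Proof. by rewrite nu0E// measure0. Qed.

Let nu0_ge0 A : (0 <= nu0 A)%E.
Proof. by rewrite /nu0; case: asboolP. Qed.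

(** If every [F n] is stable, so is the union, and the claim is that for [mu]. Otherwise the union
    is not stable either, by [stableS], and both sides are infinite. *)
Let nu0_sigma_additive : semi_sigma_additive nu0.
Proof.
move=> F mF tF mUF.
have [sF|/existsNP[n nsF]] := pselect (forall n, stable (F n)).
  rewrite nu0E; last exact: stable_bigcup.
  under eq_fun do under eq_bigr do rewrite nu0E//.
  exact: measure_semi_sigma_additive.
have -> : nu0 (\bigcup_n F n) = +oo%E.
  by apply: nu0y => sU; apply: nsF; apply: stableS sU => //; exact: bigcup_sup.
rewrite -(@eseries_pinfty _ (nu0 \o F) xpredT n)//=; last exact: nu0y.
  by apply: is_cvg_nneseries => k _ _; exact: nu0_ge0.
by move=> k _; rewrite gt_eqF// (lt_le_trans ltNy0)//; exact: nu0_ge0.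
Qed.

Let nu : {measure set T -> \bar R} :=
  HB.pack nu0 (isMeasure.Build _ _ _ nu0 nu0_0 nu0_ge0 nu0_sigma_additive).

(** Both integrals live on the support of [f], whose measurable subsets are all stable, so the two
    measures agree there. *)
Let nu_integral f : stable [set x | f x != 0] ->
  (\int[nu]_x `|(f x)%:E| = \int[mu]_x `|(f x)%:E|)%E.
Proof.
move=> sf.
have E (m : {measure set T -> \bar R}) : (\int[m]_x `|(f x)%:E| =
    \int[m]_(x in [set x | f x != 0%R]) `|(f x)%:E|)%E.
  rewrite [RHS]integral_mkcond; apply: eq_integral => x _; rewrite patchE.
  by case: ifPn => //; rewrite notin_setE => /negP/negPn/eqP ->; rewrite abse0.
rewrite !E; apply: eq_measure_integral => A mA AS.
by apply: nu0E; exact: stableS sf.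
Qed.

(** By Markov's inequality each set [|f| >= 1 / (n + 1)] has finite [nu]-measure, hence is stable;
    the support is their union. *)
Let nu_stable_supp f : nu.-integrable setT (EFin \o f) ->
  stable [set x | f x != 0].
Proof.
move=> /integrableP[mf foo].
rewrite (_ : [set x | _] =
    \bigcup_n [set x | ((n.+1%:R^-1)%:E <= `|(f x)%:E|)%E]); last first.
  apply/seteqP; split => x /=.
    rewrite -normr_gt0 => /ltr_add_invr[n]; rewrite add0r => /ltW nf.
    by exists n => //=; rewrite lee_fin.
  by move=> [n _] /=; rewrite lee_fin -normr_gt0; apply: lt_le_trans.
apply: stable_bigcup => n; apply: contrapT => nsA.
have n0 : 0 < n.+1%:R^-1 :> R by rewrite invr_gt0.
have := le_integral_abse nu measurableT mf n0.
rewrite setTI [X in (_ * X)%E](nu0y nsA) gt0_muley ?lte_fin// leye_eq => /eqP fy.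
by move: foo; rewrite [X in (X < _)%E]fy.
Qed.

Let nu_fixed f : nu.-integrable setT (EFin \o f) -> fixed f.
Proof.
move=> intf; have sf := nu_stable_supp intf.
have intmuf : integrable1 f.
  have /integrableP[mf foo] := intf.
  by apply/integrableP; split=> //; rewrite -[ltLHS](nu_integral sf).
have := sf.2 _ intmuf; congr fixed; apply/funext => x; rewrite indicE.
have [_|] := boolP (x \in _); first by rewrite mul1r.
by rewrite notin_setE => /negP/negPn/eqP ->; rewrite mulr0.
Qed.

Let fixed_nu f : fixed f -> nu.-integrable setT (EFin \o f).
Proof.
move=> ff; have [/integrableP[mf foo] _] := ff.
by apply/integrableP; split=> //; rewrite [ltLHS](nu_integral (stable_supp ff)).
Qed.

(** A [nu]-null set has finite [nu]-measure, so it is stable and its [mu]-measure is the same. *)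
Let nu_ae f g : f = g %[ae nu] -> f = g %[ae mu].
Proof.
move=> [N [mN N0 subN]]; exists N; split => //.
have [sN|nsN] := pselect (stable N); first by rewrite -(nu0E sN).
by move: N0; rewrite [nu N](nu0y nsN).
Qed.

(** [V] sends the [nu]-class of a function to its [mu]-class. Its range is the fixed space because
    the [nu]-integrable functions are exactly the fixed ones. *)
Lemma strict_contraction_fixed_L1 :
  exists (nu : {measure set T -> \bar R}) (V : {linear L1 nu -> L1 mu}),
    (forall q, `|V q| = `|q|) /\ forall p, Q p = p <-> exists q, V q = p.
Proof.
pose r (q : L1 nu) : T -> R := val (repr q : LfunType nu (@lexx _ _ 1%E)).
have intr q : nu.-integrable setT (EFin \o r q) by exact: integrable_Lfun1.
have fr q : fixed (r q) by exact: nu_fixed.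
pose v q := L1_of mu (r q).
(* The chosen representatives are additive and homogeneous only up to [nu]-null sets, which [nu_ae]
   turns into [mu]-null sets. *)
have lv : linear v.
  move=> a p q; rewrite -L1_of_linear; [|exact: (fr p).1|exact: (fr q).1].
  apply/L1_ofP; [exact: (fr _).1| |].
    by apply: integrable1_linear; [exact: (fr p).1|exact: (fr q).1].
  apply/nu_ae/L1_ofP => //.
    exact: integrable1_linear.
  by rewrite L1_of_linear// !L1_of_repr.
pose V : {linear L1 nu -> L1 mu} :=
  HB.pack v (GRing.isLinear.Build R (L1 nu) (L1 mu) *:%R v lv).
exists nu, V; split => [q|p].
  have := norm_L1_of (intr q); rewrite L1_of_repr => qE; apply: EFin_inj.
  rewrite qE (norm_L1_of (fr q).1); apply/esym/nu_integral.
  exact: nu_stable_supp.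
split=> [Qp|[q <-]]; last exact: (fr q).2.
pose f : T -> R := val (repr p : LfunType mu (@lexx _ _ 1%E)).
have pf : L1_of mu f = p by exact: L1_of_repr.
have ff : fixed f by split; [exact: integrable_Lfun1|rewrite pf].
have intf := fixed_nu ff.
exists (L1_of nu f); rewrite -pf; apply/L1_ofP; [exact: (fr _).1|exact: ff.1|].
by apply/nu_ae/L1_ofP => //; exact: L1_of_repr.
Qed.

End fixed_points.

(** * Quotients and their duals *)

Section dual_comp.
Context {R : realType} {V W : normedModType R} (A : {linear V -> W}).
Hypothesis A1 : forall v, `|A v| <= `|v|.

Let dual_compP (f : dual W) : (f \o A : V -> R^o) \in dual_pred V.
Proof.
have [F Ff _] := dual_precomp f A1.
by rewrite (_ : _ \o _ = F) ?dual_funP//; apply/funext => v; rewrite Ff.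
Qed.

(** The Banach space adjoint of the contraction [A]. *)
Definition dual_comp (f : dual W) : dual V := Dual (dual_compP f).

Let dual_comp_linear : linear dual_comp.
Proof. by move=> a f g; exact: eq_dual. Qed.

HB.instance Definition _ :=
  GRing.isLinear.Build R (dual W) (dual V) *:%R dual_comp dual_comp_linear.

Lemma dual_comp_norm (f : dual W) : `|dual_comp f| <= `|f|.
Proof.
have [F Ff Fn] := dual_precomp f A1.
by rewrite (_ : dual_comp f = F)//; apply: eq_dual => v; rewrite Ff.
Qed.

Lemma preim_subspace (G : closed_subspace W) :
  exists G' : closed_subspace V, forall v, (v \in G') = (A v \in G).
Proof.
have cA : continuous A.
  apply/linear_bounded_continuous/bounded_funP => r; exists r => v.
  exact: le_trans.
have sG : submod_closed ([pred v | A v \in G] : {pred V}).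
  split=> [|a u v]; rewrite !inE; first by rewrite linear0 rpred0.
  by move=> uG vG; rewrite linearP rpredD// rpredZ.
have cG : closed [set v | v \in Submodule sG].
  exact: (closed_comp (fun v _ => cA v) (@closed_submodP _ _ G)).
by exists (ClosedSubspace cG).
Qed.

End dual_comp.

Section quot_dual.
Context {R : realType} {X : normedModType R} (Z : closed_subspace X).

Lemma le_quot_norm c r (q : quot_space Z) : 0 <= c ->
  (forall x, quot_map Z x = q -> r <= c * `|x|) -> r <= c * `|q|.
Proof.
move=> c0 rc; apply/ler_addgt0Pr => e e0.
have c1 : 0 < c + 1 by rewrite ltr_wpDl.
(* With this slack the error is [c e / (c + 1) <= e], also when [c = 0]. *)
have [x xq xe] : exists2 x, quot_map Z x = q & `|x| < `|q| + e / (c + 1).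
  by apply: quot_norm_lift; rewrite ltrDl divr_gt0.
rewrite (le_trans (rc x xq))// (le_trans (ler_wpM2l c0 (ltW xe)))//.
by rewrite mulrDr lerD2l mulrCA ler_piMr ?(ltW e0)// ler_pdivrMr// mul1r lerDl.
Qed.

Lemma dual_quot (f : dual X) : (forall z, z \in Z -> f z = 0) ->
  exists2 F : dual (quot_space Z), (forall x, F (quot_map Z x) = f x) & `|F| <= `|f|.
Proof.
move=> fZ; pose g (q : quot_space Z) : R^o := f (repr q).
have gE x : g (quot_map Z x) = f x.
  apply/eqP; rewrite -subr_eq0 -linearB; apply/eqP/fZ.
  by apply/quot_projP; exact: quot_projK.
have lg : linear g.
  move=> a p q; have [x <-] := @quot_proj_surj R X Z p.
  have [y <-] := @quot_proj_surj R X Z q.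
  by rewrite -[quot_proj _ x]/(quot_map Z x) -[quot_proj _ y]/(quot_map Z y)
    -linearP !gE linearP.
pose G : {linear quot_space Z -> R^o} :=
  HB.pack g (GRing.isLinear.Build R (quot_space Z) R^o *:%R g lg).
have [|F FG Ff] := @bounded_dual R (quot_space Z) G `|f| (normr_ge0 _).
  by move=> q; apply: le_quot_norm => // x <-; rewrite [G _]gE dual_norm_ub.
by exists F => // x; rewrite FG [LHS]gE.
Qed.

Lemma quot_map_norm x : `|quot_map Z x| <= `|x|.
Proof. exact: quot_norm_map. Qed.

(** The adjoint of the quotient map; its range is the annihilator of [Z]. *)
Definition quot_pull : {linear dual (quot_space Z) -> dual X} :=
  dual_comp quot_map_norm.

Lemma quot_pull0 f z : z \in Z -> quot_pull f z = 0.
Proof.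
by move=> /quot_proj0 zZ; rewrite -[LHS]/(f (quot_map Z z)) [quot_map _ _]zZ linear0.
Qed.

(** [f] is the functional that [quot_pull f] induces on the quotient, and passing to the quotient
    does not increase the norm. *)
Lemma quot_pull_norm f : `|quot_pull f| = `|f|.
Proof.
apply/le_anti; rewrite dual_comp_norm/=.
have [z|F Ff] := @dual_quot (quot_pull f); first exact: quot_pull0.
suff -> : F = f by [].
apply: eq_dual => q; have [x <-] := @quot_proj_surj R X Z q.
exact: Ff.
Qed.

Lemma quot_pull_surj (f : dual X) : (forall z, z \in Z -> f z = 0) ->
  exists F, quot_pull F = f.
Proof. by move=> /dual_quot[F Ff _]; exists F; exact: eq_dual. Qed.

End quot_dual.

(** * Property-SU in quotient spaces *)

Lemma quot_property_SU (R : realType) (X : completeNormedModType R)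
    (Z Y : closed_subspace X) (ZY : {subset Z <= Y}) :
  property_SU Y -> property_SU (quot_subspace ZY).
Proof.
move=> [G [[GY0 GYD] Gstrict]].
have pull_le f : `|quot_pull Z f| <= `|f| by rewrite quot_pull_norm.
have [G' G'E] := preim_subspace pull_le G.
have annE f : f \in annihilator (quot_subspace ZY) <->
    quot_pull Z f \in annihilator Y.
  rewrite !mem_annihilator; split=> [fY y yY|fY q].
    by apply: fY; apply/mem_quot_subspace; exists y.
  by move=> /mem_quot_subspace[y yY <-]; exact: fY.
exists G'; split; [split|].
- move=> f; rewrite G'E => fG /annE fY.
  by apply/normr0_eq0; rewrite -quot_pull_norm (GY0 _ fG fY) normr0.
- move=> f; have [g [h [gG hY fgh]]] := GYD (quot_pull Z f).
  have [z zZ|g' g'E] := @quot_pull_surj _ _ Z g.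
    have /mem_annihilator/(_ z (ZY _ zZ)) hz := hY.
    have : (quot_pull Z f) z = g z + h z by rewrite fgh.
    by rewrite quot_pull0// hz addr0.
  exists g', (f - g'); rewrite G'E g'E; split=> //; last by rewrite addrC subrK.
  by apply/annE; rewrite linearB g'E fgh addrC addKr.
- move=> f g h; rewrite G'E => gG /annE hY fgh h0.
  rewrite -!(quot_pull_norm (Z := Z)).
  apply: (Gstrict _ _ (quot_pull Z h)) => //; first by rewrite fgh linearD.
  by apply: contra h0 => /eqP h0; apply/eqP/normr0_eq0; rewrite -quot_pull_norm h0 normr0.
Qed.

(** * Restriction to [Y] and the linear extension operator *)

Lemma sub_val_norm (R : realType) (X : normedModType R) (Y : closed_subspace X)
  (y : sub_space Y) : `|(val : {linear sub_space Y -> X}) y| <= `|y|.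
Proof. exact: lexx. Qed.

Section extension_operator.
Context {R : realType} {X : completeNormedModType R} (Y : closed_subspace X).

Definition dual_res : {linear dual X -> dual (sub_space Y)} :=
  dual_comp (@sub_val_norm R X Y).

Lemma dual_res_eq0 f : dual_res f = 0 <-> f \in annihilator Y.
Proof.
rewrite mem_annihilator; split=> [f0 y yY|fY].
  by rewrite -[LHS]/(dual_res f (SubSpace yY)) f0.
by apply: eq_dual => y; exact: fY (sub_valP y).
Qed.

(** [E psi] is the [G]-component of a norm-preserving extension of [psi]; discarding the other
    component does not increase the norm. *)
Lemma property_SU_extension : property_SU Y ->
  exists E : {linear dual (sub_space Y) -> dual X},
    [/\ forall psi, dual_res (E psi) = psi,
        forall psi, `|E psi| = `|psi| &
        forall f, `|E (dual_res f)| = `|f| -> E (dual_res f) = f].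
Proof.
move=> [G [[GY0 GYD] Gstrict]].
have Gle f g h : g \in G -> h \in annihilator Y -> f = g + h -> `|g| <= `|f|.
  move=> gG hY fgh; have [h0|h0] := eqVneq h 0; first by rewrite fgh h0 addr0.
  exact/ltW/(Gstrict f g h).
have Gex psi : exists g, [/\ g \in G, dual_res g = psi & `|g| <= `|psi|].
  have [F Fpsi FN] := dual_norm_ext psi.
  have [g [h [gG hY Fgh]]] := GYD F.
  exists g; split=> //; last exact: le_trans (Gle _ _ _ gG hY Fgh) FN.
  have -> : psi = dual_res F by apply: eq_dual => y; rewrite -Fpsi.
  by rewrite Fgh linearD (dual_res_eq0 h).2// addr0.
have [e eP] := choice Gex.
(* Restriction is injective on [G], since [G] meets the annihilator of [Y] only in [0]. This makes
   the chosen [e] linear. *)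
have Guniq g g' : g \in G -> g' \in G -> dual_res g = dual_res g' -> g = g'.
  move=> gG g'G gg'; apply/eqP; rewrite -subr_eq0; apply/eqP/GY0.
    exact: rpredB.
  by apply/dual_res_eq0; rewrite linearB gg' subrr.
have eG psi : e psi \in G by have [] := eP psi.
have re psi : dual_res (e psi) = psi by have [] := eP psi.
have le : linear e.
  by move=> a p q; apply: Guniq; rewrite ?rpredD ?rpredZ// linearP !re.
exists (HB.pack_for {linear dual (sub_space Y) -> dual X} e
  (GRing.isLinear.Build R (dual (sub_space Y)) (dual X) *:%R e le)).
split=> // [psi|f] /=.
  apply/le_anti; have [_ _ ->] := eP psi.
  by rewrite -[in leLHS](re psi) dual_comp_norm.
(* Extending the restriction of [f] returns its [G]-component, so equality of norms forces the
   component [h] to vanish. *)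
have [g [h [gG hY fgh]]] := GYD f.
have -> : e (dual_res f) = g.
  by apply: Guniq => //; rewrite re fgh linearD (dual_res_eq0 h).2// addr0.
have [h0|h0] := eqVneq h 0; first by rewrite fgh h0 addr0.
by have := Gstrict f g h gG hY fgh h0; rewrite lt_neqAle => /andP[/eqP].
Qed.

End extension_operator.

(** * Quotients by M-ideals *)

Lemma quot_M_ideal_L1_predual (R : realType) (X : completeNormedModType R)
    (Y : closed_subspace X) (J : closed_subspace (sub_space Y)) :
  L1_predual X -> property_SU Y -> M_ideal J -> L1_predual (quot_space J).
Proof.
move=> [d [T [mu [U [[U' UK U'K] Uiso]]]]] /property_SU_extension[E [rE Eiso Estrict]].
move=> [P [PP Prange Pnorm]].
have U'iso q : `|U' q| = `|q| by rewrite -[in RHS](U'K q) Uiso.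
have lU' : linear U' by move=> a p q; apply: (can_inj UK); rewrite linearP !U'K.
have PJ f : f \in annihilator J <-> P f = f.
  have -> : (f \in annihilator J) = (range P f) :> Prop by rewrite Prange.
  by split=> [[g _ <-]|<-//]; rewrite ?PP.
have Ple f : `|P f| <= `|f| by rewrite [leRHS]Pnorm lerDl.
have Pstrict f : `|P f| = `|f| -> P f = f.
  move=> Pf; apply/esym/eqP; rewrite -subr_eq0 -normr_eq0; apply/eqP.
  by apply: (addrI `|P f|); rewrite addr0 -Pnorm.
pose res := dual_res Y.
pose q p := U (E (P (res (U' p)))).
have lq : linear q by move=> a u v; rewrite /q lU' !linearP.
pose Q : {linear L1 mu -> L1 mu} :=
  HB.pack q (GRing.isLinear.Build R (L1 mu) (L1 mu) *:%R q lq).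
have res_le f : `|res f| <= `|f| by exact: dual_comp_norm.
have Qle p : `|Q p| <= `|p|.
  rewrite [`|Q p|]Uiso Eiso (le_trans (Ple _))// (le_trans (res_le _))//.
  by rewrite U'iso.
(* Equality of norms for the composite forces it for the restriction and for [P]. Strictness then
   removes [P] first and the extension of the restriction next. *)
have Qstrict p : `|Q p| = `|p| -> Q p = p.
  rewrite [`|Q p|]Uiso Eiso -(U'iso p) => Pp.
  have resp : `|res (U' p)| = `|U' p|.
    by apply/le_anti; rewrite res_le/= -Pp Ple.
  rewrite -[Q p]/(U (E (P (res (U' p))))) Pstrict ?Pp//.
  by rewrite Estrict ?U'K// Eiso.
have [nu [V [Viso Vfix]]] := strict_contraction_fixed_L1 Qle Qstrict.
have Vinj : injective V.
  move=> u v uv; apply/eqP; rewrite -subr_eq0 -normr_eq0 -Viso linearB uv.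
  by rewrite subrr normr0.
(* [w] is an isometry of the dual of the quotient onto the fixed space of [Q]. The final isometry
   [t] is [w] followed by the inverse of [V] on that space. *)
pose w : {linear dual (quot_space J) -> L1 mu} := U \o E \o quot_pull J.
have wiso f : `|w f| = `|f| by rewrite /w/= Uiso Eiso quot_pull_norm.
have Qw f : Q (w f) = w f.
  rewrite -[LHS]/(U (E (P (res (U' (U (E (quot_pull J f)))))))) UK [res _]rE.
  rewrite (PJ _).1//; apply/mem_annihilator => y; exact: quot_pull0.
(* A fixed [p] is the image under [U] and [E] of a functional in the range of [P], that is, in the
   annihilator of [J]. *)
have wsurj p : Q p = p -> exists f, w f = p.
  move=> Qp; have [|f fE] := @quot_pull_surj _ _ J (P (res (U' p))).
    by apply/mem_annihilator/PJ; rewrite PP.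
  by exists f; rewrite /w/= fE.
have /choice[t tE] : forall f, exists u, V u = w f by move=> f; exact/Vfix.
have lt : linear t.
  by move=> a f g; apply: Vinj; rewrite linearP !tE linearP.
exists d, T, nu, (HB.pack_for {linear dual (quot_space J) -> L1 nu} t
  (GRing.isLinear.Build R (dual (quot_space J)) (L1 nu) *:%R t lt)).
split=> /= [|f]; last by rewrite -Viso tE.
have /choice[s sE] : forall v, exists f, t f = v.
  move=> v; have [|f wf] := wsurj (V v); first by apply/Vfix; exists v.
  by exists f; apply: Vinj; rewrite tE.
exists s => // f; apply/eqP; rewrite -subr_eq0 -normr_eq0 -wiso.
by rewrite linearB -!tE sE subrr normr0.
Qed.

Theorem theorem4p1 (R : realType) :
  (forall (X : completeNormedModType R) (Z Y : closed_subspace X)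
      (ZY : {subset Z <= Y}),
    property_SU Y -> property_SU (quot_subspace ZY))
  /\ (forall (X : completeNormedModType R) (Y : closed_subspace X)
      (J : closed_subspace (sub_space Y)),
    L1_predual X -> property_SU Y -> M_ideal J -> L1_predual (quot_space J)).
Proof.
split=> [X Z Y ZY|X Y J]; first exact: quot_property_SU.
exact: quot_M_ideal_L1_predual.
Qed.
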